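(* Let $L$ be a directed complete poset such that the set $Id(L)$ of all non-trivial ideals of $L$ is countable. If the Scott space $\Sigma L$ is coherent and well-filtered, then $\Sigma L$ is sober.
   Context: A nonempty subset $D$ of a poset is directed if every two elements of $D$ have an upper bound in $D$; a poset is directed complete (a dcpo) if each of its directed subsets has a supremum. An ideal is a directed lower set. An ideal is non-trivial if it has no greatest element; $Id(L)$ denotes the set of all non-trivial ideals of $L$. A subset $U$ of a poset $L$ is Scott open if it is an upper set and, for every directed $D\subseteq L$ whose supremum exists with $\sup D\in U$, one has $D\cap U\neq\emptyset$. The Scott open sets form the Scott topology $\sigma(L)$, and $\Sigma L=(L,\sigma(L))$. A subset of a space is saturated if it is the intersection of its open neighbourhoods. A space is coherent if the intersection of any two compact saturated sets is compact (compactness does not include Hausdorff). A $T_0$ space is well-filtered if for each filter basis $\mathcal{C}$ of compact saturated sets and each open set $U$ with $\bigcap\mathcal{C}\subseteq U$ there is $K\in\mathcal{C}$ with $K\subseteq U$. A space is sober if it is $T_0$ and every irreducible closed subset is the closure of a (unique) point. *)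

(* Defs.v *)
From HB Require Import structures.
From mathcomp Require Import all_boot all_order.
From mathcomp Require Import boolp classical_sets cardinality.
From mathcomp Require Import topology_structure compact separation_axioms.

Set Implicit Arguments.
Unset Strict Implicit.
Unset Printing Implicit Defensive.

Local Open Scope classical_set_scope.
Local Open Scope order_scope.

Definition directed d (L : porderType d) (D : set L) : Prop :=
  D !=set0 /\
  forall x y, D x -> D y -> exists z, [/\ D z, x <= z & y <= z].

Definition dcpo d (L : porderType d) : Prop :=
  forall D : set L, directed D -> supremums D !=set0.

Definition upper_set d (L : porderType d) (U : set L) : Prop :=
  forall x y, U x -> x <= y -> U y.

Definition lower_set d (L : porderType d) (I : set L) : Prop :=
  forall x y, I y -> x <= y -> I x.

Definition ideal d (L : porderType d) (I : set L) : Prop :=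
  directed I /\ lower_set I.

Definition has_greatest d (L : porderType d) (A : set L) : Prop :=
  exists2 m, A m & ubound A m.

Definition Id d (L : porderType d) : set (set L) :=
  [set I | ideal I /\ ~ has_greatest I].

Arguments Id {d} L _.

Definition scott_open d (L : porderType d) (U : set L) : Prop :=
  upper_set U /\
  forall (D : set L) s, directed D -> supremums D s -> U s -> D `&` U !=set0.

(* A separate name for the carrier, so that the Scott topology cannot clash
   with another topology that [L] may carry. *)
Definition scott_space d (L : porderType d) : Type := L.

Section scott_topology.
Context d (L : porderType d).

HB.instance Definition _ := Choice.on (scott_space L).

Let scott_openT : scott_open [set: L].
Proof. by split=> // D s [[x Dx] _] _ _; exists x. Qed.

Let scott_openI : setI_closed (@scott_open d L).
Proof.
move=> U V [uU sU] [uV sV]; split=> [x y [Ux Vx] xy|D s dD Ds [Us Vs]].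
  by split; [exact: uU xy|exact: uV xy].
have [x [Dx Ux]] := sU _ _ dD Ds Us.
have [y [Dy Vy]] := sV _ _ dD Ds Vs.
have [z [Dz xz yz]] := dD.2 _ _ Dx Dy.
by exists z; split=> //; split; [exact: uU xz|exact: uV yz].
Qed.

Let scott_open_bigU (I : Type) (f : I -> set L) :
  (forall i, scott_open (f i)) -> scott_open (\bigcup_i f i).
Proof.
move=> fo; split=> [x y [i _ fx] xy|D s dD Ds [i _ fs]].
  by exists i => //; exact: (fo i).1 xy.
by have [x [Dx fx]] := (fo i).2 _ _ dD Ds fs; exists x; split=> //; exists i.
Qed.

HB.instance Definition _ := isOpenTopological.Build (scott_space L)
  scott_openT scott_openI scott_open_bigU.

Lemma open_scott (U : set (scott_space L)) : open U = @scott_open d L U.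
Proof. by []. Qed.

End scott_topology.

Definition saturated (X : topologicalType) (A : set X) : Prop :=
  A = \bigcap_(U in [set U | open U /\ A `<=` U]) U.

Definition coherent (X : topologicalType) : Prop :=
  forall A B : set X, compact A -> saturated A -> compact B -> saturated B ->
    compact (A `&` B).

Definition filter_basis (T : Type) (C : set (set T)) : Prop :=
  C !=set0 /\
  forall A B, C A -> C B -> exists2 K, C K & K `<=` A `&` B.

Definition well_filtered (X : topologicalType) : Prop :=
  kolmogorov_space X /\
  forall (C : set (set X)) (U : set X),
    filter_basis C -> (forall K, C K -> compact K /\ saturated K) ->
    open U -> \bigcap_(K in C) K `<=` U -> exists2 K, C K & K `<=` U.

Definition irreducible (X : topologicalType) (A : set X) : Prop :=
  A !=set0 /\
  forall B C : set X, closed B -> closed C -> A `<=` B `|` C ->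
    A `<=` B \/ A `<=` C.

Definition sober (X : topologicalType) : Prop :=
  kolmogorov_space X /\
  forall A : set X, closed A -> irreducible A ->
    exists! x : X, A = closure [set x].

(* Main.v *)
(* In a well-filtered coherent dcpo, for a closed set [A] the relation
   [W x y : ↑x ∩ ↑y ∩ A = ∅] is Scott open in each variable, since the sets
   [↑x ∩ ↑y] are compact saturated and their filtered intersections behave well.
   Countability of the non-trivial ideals makes separately Scott open relations
   open in the product topology: a rectangle inside [W] is grown from a point by
   visiting every ideal infinitely often, each time adding one of its elements to
   the finitely many generators of either side whenever [W] permits.
   If [A] is irreducible and [W x y] held with [x], [y] in [A], the two sides of
   the rectangle would meet [A] in a common point [z], and [W z z] is absurd.
   So [A] is directed, and is the closure of its supremum. *)
Require Import Defs.
From mathcomp Require Import all_boot all_order.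
From mathcomp Require Import boolp classical_sets cardinality.
From mathcomp Require Import topology_structure compact separation_axioms.

Set Implicit Arguments.
Unset Strict Implicit.
Unset Printing Implicit Defensive.

Import Order.TTheory.
Local Open Scope classical_set_scope.
Local Open Scope order_scope.

(** The 2-adic valuation on [nat] takes every value at arbitrarily large arguments, so it can carry
    the code of the set. *)
Lemma countable_enum_infinitely_often (T : Type) (A : set (set T)) :
  countable A ->
  exists e : nat -> set T, forall I, A I -> forall m, exists n, (m <= n)%N /\ e n = I.
Proof.
move=> /countable_injP[f finj].
(* At most one [I] in [A] has code [logn 2 n]: the union is that [I], or empty if there is none. *)
exists (fun n => \bigcup_(I in [set I | A I /\ f I = logn 2 n]) I) => I AI m.
exists (2 ^ f I * m.*2.+1)%N; split.
  apply: (@leq_trans m.*2.+1); first by rewrite -addnn ltnW // ltnS leq_addr.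
  by rewrite leq_pmull // expn_gt0.
have -> : logn 2 (2 ^ f I * m.*2.+1) = f I.
  rewrite lognM ?expn_gt0 // pfactorK // lognE /= dvdn2 /= odd_double /=.
  by rewrite addn0.
apply/seteqP; split=> [x [J [AJ fJ]] Jx|x Ix]; last by exists I.
by rewrite -(finj J I) // inE.
Qed.

Section posets.
Context d (L : porderType d).
Implicit Types (D U V A I : set L) (x y z : L).

(** The lower closure of a directed [D] is an ideal with the same supremum. If it has a greatest
    element, then some member of [D] lies above the supremum, hence in [U]. *)
Lemma scott_open_Id U : upper_set U ->
  (forall I s, Id L I -> supremums I s -> U s -> I `&` U !=set0) ->
  scott_open U.
Proof.
move=> upU UI; split=> // D s [[x0 Dx0] dirD] [ubs lubs] Us.
pose I : set L := [set x | exists2 y, D y & x <= y].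
have sI : supremums I s.
  split=> [x [y Dy xy]|z ubz]; first exact: le_trans xy (ubs _ Dy).
  by apply: lubs => y Dy; apply: ubz; exists y.
have idI : ideal I.
  split; last by move=> x y [z Dz yz] xy; exists z => //; exact: le_trans yz.
  split; first by exists x0, x0.
  move=> x y [x' Dx' xx'] [y' Dy' yy'].
  have [z [Dz x'z y'z]] := dirD _ _ Dx' Dy'.
  by exists z; split; [exists z|exact: le_trans x'z|exact: le_trans y'z].
have [[m [y Dy my] ubm]|nI] := pselect (has_greatest I).
  have sy : s <= y by apply: le_trans (sI.2 m ubm) my.
  by exists y; split=> //; exact: upU sy.
have [x [[y Dy xy] Ux]] := UI I s (conj idI nI) sI Us.
by exists y; split=> //; exact: upU xy.
Qed.

Lemma directed_common (R : L -> set L) (D : set L) (t : seq L) :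
  directed D -> (forall b, upper_set (R^~ b)) ->
  (forall b, b \in t -> exists2 x, D x & R x b) ->
  exists x, D x /\ forall b, b \in t -> R x b.
Proof.
move=> [[x0 Dx0] dirD] upR; elim: t => [_|b t IH Rt]; first by exists x0.
have [c ct|x [Dx Rx]] := IH; first by apply: Rt; rewrite inE ct orbT.
have [|y Dy Ry] := Rt b; first by rewrite mem_head.
have [z [Dz xz yz]] := dirD _ _ Dx Dy.
exists z; split=> // c; rewrite inE => /predU1P[->|ct]; first exact: upR Ry yz.
exact: upR (Rx _ ct) xz.
Qed.

Definition extend (R : L -> set L) (D : set L) (s t : seq L) : seq L :=
  match pselect (exists x, D x /\ forall b, b \in t -> R x b) with
  | left h => sval (cid h) :: s
  | right _ => s
  end.

Lemma extend_sub R D s t : {subset s <= extend R D s t}.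
Proof.
by rewrite /extend => x; case: pselect => // h xs; rewrite inE xs orbT.
Qed.

Lemma extend_rectangle (R : L -> set L) D s t :
  (forall a b, a \in s -> b \in t -> R a b) ->
  forall a b, a \in extend R D s t -> b \in t -> R a b.
Proof.
rewrite /extend; case: pselect => // h Rst a b.
case: (cid h) => x [_ Rx] /=; rewrite inE => /predU1P[->|]; first exact: Rx.
exact: Rst.
Qed.

(** Since [z] is above [a], it is related to all of [t]. Openness gives a member of [D] for each [b]
    in [t], and directedness merges these finitely many into one, so [extend] does add an
    element. *)
Lemma extend_meets (R : L -> set L) D s t a z :
  (forall b, scott_open (R^~ b)) ->
  (forall a b, a \in s -> b \in t -> R a b) ->
  directed D -> supremums D z -> a \in s -> a <= z ->
  exists2 x, D x & x \in extend R D s t.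
Proof.
move=> oR Rst dirD Dz sa az; rewrite /extend.
case: pselect => [h|[]].
  by case: (cid h) => x [Dx _] /=; exists x => //; exact: mem_head.
apply: directed_common => // [b|b tb]; first exact: (oR b).1.
have Rz : R z b by exact: (oR b).1 (Rst _ _ sa tb) az.
by have [x [Dx Rx]] := (oR b).2 D z dirD Dz Rz; exists x.
Qed.

(** The second side is extended against the already enlarged first side, which keeps the rectangle
    inside [W]. *)
Fixpoint grow (W : L -> set L) (e : nat -> set L) x y n : seq L * seq L :=
  if n is m.+1 then
    let st := grow W e x y m in
    let s := extend W (e m) st.1 st.2 in
    (s, extend (fun b a => W a b) (e m) st.2 s)
  else ([:: x], [:: y]).

Lemma grow_sub W e x y m n : (m <= n)%N ->
  {subset (grow W e x y m).1 <= (grow W e x y n).1} /\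
  {subset (grow W e x y m).2 <= (grow W e x y n).2}.
Proof.
elim: n => [|n IH]; first by rewrite leqn0 => /eqP->; split.
rewrite leq_eqVlt => /predU1P[->|]; first by split.
rewrite ltnS => /IH[s1 s2].
by split=> z zm /=; apply: extend_sub; [exact: s1|exact: s2].
Qed.

Lemma grow_rectangle (W : L -> set L) e x y n : W x y ->
  forall a b, a \in (grow W e x y n).1 -> b \in (grow W e x y n).2 -> W a b.
Proof.
move=> Wxy; elim: n => [a b|n IH a b] /=.
  by rewrite !inE => /eqP-> /eqP->.
move=> sa tb; apply: (@extend_rectangle (fun b a => W a b)) tb sa => {a b} b a tb sa.
exact: extend_rectangle sa tb.
Qed.

Lemma scott_open_rectangle (W : L -> set L) x y :
  countable (Id L) ->
  (forall a, scott_open (W a)) -> (forall b, scott_open (W^~ b)) -> W x y ->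
  exists U V, [/\ scott_open U, scott_open V, U x, V y &
    forall u v, U u -> V v -> W u v].
Proof.
move=> /countable_enum_infinitely_often[e eP] oW1 oW2 Wxy.
pose st := grow W e x y.
(* The two open sets are the upper closures of the generators of all stages. *)
exists [set z | exists n, exists2 a, a \in (st n).1 & a <= z].
exists [set z | exists n, exists2 a, a \in (st n).2 & a <= z].
have W_st n := @grow_rectangle W e x y n Wxy.
split.
- apply: scott_open_Id => [u v [n [a sa au]] uv|I z II Iz [m [a sa az]]].
    by exists n; exists a => //; exact: le_trans au uv.
  (* A visit to [I] no earlier than stage [m] is required, so that the generator [a] below [z] is
     already present. *)
  have [n [mn en]] := eP I II m.
  have [||||w Iw sw] := @extend_meets W I (st n).1 (st n).2 a z oW2 (W_st n).
  + exact: II.1.1.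
  + exact: Iz.
  + exact: (grow_sub _ _ _ _ mn).1.
  + exact: az.
  by exists w; split=> //; exists n.+1, w => //=; rewrite en.
- apply: scott_open_Id => [u v [n [a sa au]] uv|I z II Iz [m [a sa az]]].
    by exists n; exists a => //; exact: le_trans au uv.
  have [n [mn en]] := eP I II m.
  have [|||||w Iw sw] := @extend_meets (fun b a => W a b) I (st n).2
      (extend W I (st n).1 (st n).2) a z oW1.
  + by move=> b c tb sc; exact: (extend_rectangle (W_st n)) sc tb.
  + exact: II.1.1.
  + exact: Iz.
  + exact: (grow_sub _ _ _ _ mn).2.
  + exact: az.
  by exists w; split=> //; exists n.+1, w => //=; rewrite en.
- by exists 0%N, x => //=; rewrite inE.
- by exists 0%N, y => //=; rewrite inE.
- move=> u v [m [a sa au]] [n [b tb bv]].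
  apply: (oW1 u).1 bv; apply: (oW2 b).1 au; apply: (W_st (maxn m n)).
  + exact: (grow_sub _ _ _ _ (leq_maxl m n)).1.
  + exact: (grow_sub _ _ _ _ (leq_maxr m n)).2.
Qed.

Lemma open_not_below z : open ([set x | ~ x <= z] : set (scott_space L)).
Proof.
rewrite open_scott; split=> [x y nx xy yz|D s dirD [ubs lubs] nsz].
  by apply: nx; exact: le_trans yz.
apply: contrapT => D0; apply: nsz; apply: lubs => x Dx.
by apply: contrapT => nxz; apply: D0; exists x.
Qed.

Lemma closure_scott1 x :
  closure ([set x] : set (scott_space L)) = [set z | z <= x].
Proof.
apply/seteqP; split=> z.
  move=> clz; apply: contrapT => nzx.
  have [|w [/= -> ]] := clz [set y | ~ y <= x]; last by apply; exact: lexx.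
  by apply: open_nbhs_nbhs; split=> //; exact: open_not_below.
move=> zx B; rewrite nbhsE => -[V [oV Vz] VB].
exists x; split=> //; apply: VB.
by move: oV; rewrite open_scott => -[upV _]; exact: upV zx.
Qed.

(** Every neighbourhood of [x] contains all of its upper set, so [x] is a cluster point of each
    proper filter containing that set. *)
Lemma compact_above x : compact ([set z | x <= z] : set (scott_space L)).
Proof.
move=> F PF Fx; exists x; split=> [|P B FP]; first exact: lexx.
rewrite nbhsE => -[V [oV Vx] VB].
have [z [Pz xz]] := filter_ex (filterI FP Fx).
exists z; split=> //; apply: VB.
by move: oV; rewrite open_scott => -[upV _]; exact: upV xz.
Qed.

Lemma saturated_upper (B : set (scott_space L)) :
  upper_set (B : set L) -> saturated B.
Proof.
move=> upB; apply/seteqP; split=> [z Bz U [_]|z Uz]; first exact.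
apply: contrapT => nBz.
apply: (Uz [set y : L | ~ y <= z]); last exact: lexx.
split; first exact: open_not_below.
by move=> y By yz; apply: nBz; exact: upB yz.
Qed.

Lemma no_upper_bound_scott_open A x :
  coherent (scott_space L) -> well_filtered (scott_space L) ->
  closed (A : set (scott_space L)) ->
  scott_open [set y | forall z, x <= z -> y <= z -> ~ A z].
Proof.
move=> coh [_ wf] clA.
split=> [y y' Wy yy' z xz y'z|D s [[d0 Dd0] dirD] [ubs lubs] Ws].
  by apply: Wy => //; exact: le_trans y'z.
pose K y : set (scott_space L) := [set z : L | x <= z] `&` [set z : L | y <= z].
(* A point common to all [K y] is above [x] and [s], hence outside [A]; well-filteredness puts a
   single [K y] outside [A]. *)
have [|B [y Dy <-]||z Kz|B [y Dy <-] KA] := wf (K @` D) (~` A).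
- split; first by exists (K d0), d0.
  move=> _ _ [a Da <-] [b Db <-]; have [c [Dc ac bc]] := dirD _ _ Da Db.
  exists (K c); first by exists c.
  by move=> z [xz cz]; split; split=> //; exact: le_trans cz.
- split.
    by apply: coh; try exact: compact_above;
      apply: saturated_upper => u v; exact: le_trans.
  by apply: saturated_upper => u v [xu yu] uv; split; exact: le_trans uv.
- exact: closed_openC.
- apply: (Ws z); first by have [] := Kz (K d0) (ex_intro2 _ _ d0 Dd0 erefl).
  by apply: lubs => y Dy; have [] := Kz (K y) (ex_intro2 _ _ y Dy erefl).
- by exists y; split=> // z xz yz; apply: KA.
Qed.

Lemma closed_irreducible_directed A :
  countable (Id L) ->
  coherent (scott_space L) -> well_filtered (scott_space L) ->
  closed (A : set (scott_space L)) -> irreducible (A : set (scott_space L)) ->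
  directed A.
Proof.
move=> cI coh wf clA [A0 irrA]; split=> // x y Ax Ay.
apply: contrapT => nz.
pose W a : set L := [set b | forall z, a <= z -> b <= z -> ~ A z].
have oW a : scott_open (W a) by exact: no_upper_bound_scott_open.
have oW' b : scott_open (W^~ b).
  suff -> : W^~ b = W b by [].
  by apply/seteqP; split=> a Wab z az bz; exact: Wab.
have Wxy : W x y by move=> z xz yz Az; apply: nz; exists z.
have [U [V [oU oV Ux Vy UV]]] := scott_open_rectangle cI oW oW' Wxy.
(* A point [z] of [A] in both [U] and [V] would satisfy [W z z], so the two complements cover
   [A]. *)
have [||z Az|AU|AV] := irrA (~` U) (~` V).
- by apply: open_closedC; rewrite open_scott.
- by apply: open_closedC; rewrite open_scott.
- apply: contrapT => /not_orP[/contrapT Uz /contrapT Vz].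
  exact: UV Uz Vz z (lexx z) (lexx z) Az.
- exact: AU Ax Ux.
- exact: AV Ay Vy.
Qed.

End posets.

Theorem corollary3p3 (d : Order.disp_t) (L : porderType d)
  (dcpoL : dcpo L) (countId : countable (Id L))
  (cohL : coherent (scott_space L)) (wfL : well_filtered (scott_space L)) :
  sober (scott_space L).
Proof.
split=> [|A clA irrA]; first exact: wfL.1.
have dirA := closed_irreducible_directed countId cohL wfL clA irrA.
have [s sA] := dcpoL A dirA.
have [upCA CA] : scott_open (~` A : set L).
  by rewrite -open_scott; exact: closed_openC.
(* Otherwise [s] lies in the open complement of [A], which must then meet the directed set [A]. *)
have As : A s.
  by apply: contrapT => nAs; have [z [Az]] := CA A s dirA sA nAs; apply.
exists s; split=> [|t].
  rewrite closure_scott1; apply/seteqP; split=> z; first exact: sA.1.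
  by move=> zs; apply: contrapT => nAz; exact: upCA nAz zs As.
rewrite closure_scott1 => At; apply/le_anti/andP; split.
  by have : [set z : L | z <= t] s by rewrite -At.
by apply: sA.1; rewrite At /=.
Qed.
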